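(* Let $\Omega\subset\widehat\Omega$ be finite sets. Let $K$ be an ergodic, irreducible, reversible Markov kernel on $\widehat\Omega$ with stationary distribution $\mu$, and let $Q$ be an ergodic, irreducible, reversible Markov kernel on $\Omega$ with stationary distribution $\nu$ (no laziness is assumed). Let $\widehat E=\{(x,y)\in\widehat\Omega^2:K(x,y)>0\}$ and $E=\{(x,y)\in\Omega^2:Q(x,y)>0\}$. Fix probability measures $\{P_x\}_{x\in\widehat\Omega}$ on $\Omega$ with $P_x=\delta_x$ for $x\in\Omega$, couplings $\{P_{x,y}\}_{(x,y)\in\widehat E}$ of $P_x$ and $P_y$, and a flow $F$ (as defined in the context) that is concentrated on paths of odd length, i.e. $F[\gamma]=0$ whenever $k[\gamma]$ is even. Then for every $f:\Omega\to\mathbb{R}$, the extension $\widehat f(x)=\sum_{y\in\Omega}P_x[y]f(y)$, $x\in\widehat\Omega$, satisfies $$\mathcal{F}_K(\widehat f,\widehat f)\le\mathcal{A}\,\mathcal{F}_Q(f,f),$$ where $$\begin{aligned}\mathcal{A}=\sup_{Q(q,r)>0}\frac1{Q(q,r)\nu(q)}\Big(&\sum_{\gamma\ni(q,r)}F[\gamma]\,t_{(q,r)}(\gamma)\,k[\gamma]\,K(i(\gamma),o(\gamma))\mu(i(\gamma))\\&+2\sum_{\gamma\ni(q,r)}t_{(q,r)}(\gamma)\,k[\gamma]\,F[\gamma]\sum_{y\in\widehat\Omega\setminus\Omega}P_y[o(\gamma)]K(i(\gamma),y)\mu(i(\gamma))\\&+\sum_{\gamma\ni(q,r)}F[\gamma]\,t_{(q,r)}(\gamma)\,k[\gamma]\sum_{(x,y)\in\widehat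 E,\;x,y\notin\Omega}P_{x,y}[i(\gamma),o(\gamma)]K(x,y)\mu(x)\Big).\end{aligned}$$
   Context: For a kernel $P$ on a finite set $X$ with stationary distribution $\pi$, $\mathcal{F}_P(f,f)=\frac12\sum_{x,y\in X}|f(x)+f(y)|^2P(x,y)\pi(x)$. Couplings: for each $(x,y)\in\widehat E$, $P_{x,y}$ is a probability measure on $\Omega\times\Omega$ with $\sum_bP_{x,y}[a,b]=P_x[a]$ for all $a\in\Omega$ and $\sum_aP_{x,y}[a,b]=P_y[b]$ for all $b\in\Omega$. A path from $a$ to $b$ is a finite sequence $\gamma=(a=v_0,v_1,\dots,v_{k[\gamma]}=b)$ of elements of $\Omega$ with $(v_i,v_{i+1})\in E$ for $0\le i<k[\gamma]$; $k[\gamma]$ is its length, $i(\gamma)=a$ its initial vertex, $o(\gamma)=b$ its final vertex. $\Gamma_{a,b}$ is the set of all paths from $a$ to $b$. A flow is a function $F$ from paths to $[0,1]$ with $\sum_{\gamma\in\Gamma_{a,b}}F[\gamma]=1$ for all $a,b\in\Omega$. For an edge $(q,r)\in E$, $t_{(q,r)}(\gamma)$ is the number of times $(q,r)$ is traversed by $\gamma$, i.e. the number of $0\le i<k[\gamma]$ with $(v_i,v_{i+1})=(q,r)$, and $\gamma\ni(q,r)$ means $t_{(q,r)}(\gamma)\ge1$. *)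

(* Defs.v *)
From HB Require Import structures.
From mathcomp Require Import all_boot all_order all_algebra.
From mathcomp Require Import classical_sets reals ereal esum.

Set Implicit Arguments.
Unset Strict Implicit.
Unset Printing Implicit Defensive.

Import Order.TTheory GRing.Theory Num.Theory.
Local Open Scope classical_set_scope.
Local Open Scope ring_scope.

Section Kernels.
Context {R : realType} {S : finType}.
Implicit Types (p pi : S -> R) (P : S -> S -> R).

Definition is_dist p := (forall x, 0 <= p x) /\ \sum_x p x = 1.

Definition is_kernel P := forall x, is_dist (P x).

Fixpoint kernel_pow P (n : nat) (x y : S) : R :=
  if n is m.+1 then \sum_z P x z * kernel_pow P m z y else (x == y)%:R.

Definition irreducible P := forall x y, exists n, 0 < kernel_pow P n x y.

Definition aperiodic P := forall x (d : nat),
  (forall n : nat, (0 < n)%N -> 0 < kernel_pow P n x x -> (d %| n)%N) -> d = 1%N.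

(* On a finite state space, ergodic means irreducible with all periods 1. *)
Definition ergodic P := irreducible P /\ aperiodic P.

Definition stationary P pi :=
  is_dist pi /\ forall y, \sum_x pi x * P x y = pi y.

Definition reversible P pi := forall x y, pi x * P x y = pi y * P y x.

Definition edge P : rel S := fun x y => 0 < P x y.

Definition sum_form P pi (f : S -> R) : R :=
  2^-1 * \sum_x \sum_y `|f x + f y| ^+ 2 * P x y * pi x.

End Kernels.

Section Paths.
Context {S : finType} (e : rel S).

(* The path v_0, v_1, ..., v_k is encoded as (v_0, [:: v_1; ...; v_k]), so its
   length is the size of the second component; k = 0 is allowed. *)
Definition epath : Type := {g : S * seq S | path e g.1 g.2}.

HB.instance Definition _ := Choice.on epath.

Definition plen (g : epath) : nat := size (val g).2.
Definition pinit (g : epath) : S := (val g).1.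
Definition pfinal (g : epath) : S := last (val g).1 (val g).2.

(* pairmap pair lists the consecutive pairs (v_i, v_(i+1)), 0 <= i < k. *)
Definition traversals (qr : S * S) (g : epath) : nat :=
  count_mem qr (pairmap pair (val g).1 (val g).2).

Definition paths_from_to (a b : S) : set epath :=
  [set g | pinit g = a /\ pfinal g = b].

Definition paths_through (qr : S * S) : set epath :=
  [set g | (1 <= traversals qr g)%N].

Definition is_flow {R : realType} (F : epath -> R) :=
  (forall g, 0 <= F g <= 1) /\
  forall a b, \esum_(g in paths_from_to a b) (F g)%:E = 1%E.

End Paths.

Arguments paths_through {S} e qr _.

Section Comparison.
Context {R : realType} {T : finType} {Om : {set T}}.

Local Notation V := {x : T | x \in Om}.

Definition is_coupling (c : V * V -> R) (p p' : V -> R) :=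
  [/\ is_dist c,
      forall a, \sum_b c (a, b) = p a
    & forall b, \sum_a c (a, b) = p' b].

Definition extension (P : T -> V -> R) (f : V -> R) (x : T) : R :=
  \sum_y P x y * f y.

Variables (K : T -> T -> R) (mu : T -> R) (Q : V -> V -> R) (nu : V -> R).
Variables (P : T -> V -> R) (C : T -> T -> V * V -> R).
Variable F : epath (edge Q) -> R.

Definition edge_congestion (qr : V * V) : \bar R :=
  (((Q qr.1 qr.2 * nu qr.1)^-1)%:E *
   ((\esum_(g in paths_through (edge Q) qr)
      (F g * (traversals qr g)%:R * (plen g)%:R *
       (K (val (pinit g)) (val (pfinal g)) * mu (val (pinit g))))%:E)
    + 2%:E * (\esum_(g in paths_through (edge Q) qr)
      ((traversals qr g)%:R * (plen g)%:R * F g *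
       (\sum_(y | y \notin Om)
         P y (pfinal g) * K (val (pinit g)) y * mu (val (pinit g))))%:E)
    + (\esum_(g in paths_through (edge Q) qr)
      (F g * (traversals qr g)%:R * (plen g)%:R *
       (\sum_(xy : T * T | [&& edge K xy.1 xy.2, xy.1 \notin Om & xy.2 \notin Om])
         C xy.1 xy.2 (pinit g, pfinal g) * K xy.1 xy.2 * mu xy.1))%:E)))%E.

(* Path lengths are unbounded, so the constant lives in the extended reals. *)
Definition comparison_constant : \bar R :=
  ereal_sup [set edge_congestion qr | qr in [set qr | 0 < Q qr.1 qr.2]].

End Comparison.

(* Main.v *)
(* By Jensen's inequality along the couplings, F_K(f^, f^) is at most
   1/2 sum_(a, b) w(a, b) (f a + f b)^2 for an explicit weight w on Om * Om.
   On a path of odd length k, f(v_0) + f(v_k) is the alternating sum of the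
   f(v_i) + f(v_(i+1)), so by Cauchy-Schwarz its square is at most
   k sum_i (f(v_i) + f(v_(i+1)))^2. Averaging this over the flow and exchanging
   the sums over paths and over edges bounds the right-hand side by
   1/2 sum_(q, r) (f q + f r)^2 S(q, r), and the supremum A satisfies
   S(q, r) <= A Q(q, r) nu(q) on every edge, as nu is positive. *)
Require Import Defs.
From mathcomp Require Import all_boot all_order all_algebra.
From mathcomp Require Import classical_sets reals ereal esum.
From mathcomp Require Import ring lra.

Set Implicit Arguments.
Unset Strict Implicit.
Unset Printing Implicit Defensive.

Import Order.TTheory GRing.Theory Num.Theory.
Local Open Scope ring_scope.

(** * Square inequalities for means and for alternating sums along paths *)

(** The difference of the two sides is the variance of [u] under [p]. *)
Lemma sqr_mean_le (R : realDomainType) (I : finType) (p u : I -> R) :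
  (forall i, 0 <= p i) -> \sum_i p i = 1 ->
  (\sum_i p i * u i) ^+ 2 <= \sum_i p i * u i ^+ 2.
Proof.
move=> p0 p1; set m := \sum_i p i * u i.
have var0 : 0 <= \sum_i p i * (u i - m) ^+ 2.
  by apply: sumr_ge0 => i _; rewrite mulr_ge0// sqr_ge0.
suff varE : \sum_i p i * (u i - m) ^+ 2 = \sum_i p i * u i ^+ 2 - m ^+ 2.
  by rewrite varE subr_ge0 in var0.
transitivity (\sum_i (p i * u i ^+ 2 - 2 * m * (p i * u i) + m ^+ 2 * p i)).
  by apply: eq_bigr => i _; ring.
rewrite big_split /= sumrB -!mulr_sumr p1 -/m; ring.
Qed.

(* Along a path the terms (-1)^i (f v_i + f v_(i+1)) telescope to
   f v_0 - (-1)^k f v_k. *)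
Lemma alternating_path_sqr_le (R : realFieldType) (S : eqType) (f : S -> R)
    (x : S) (s : seq S) :
  (f x - (-1) ^+ size s * f (last x s)) ^+ 2 <=
  (size s)%:R * \sum_(e <- pairmap pair x s) (f e.1 + f e.2) ^+ 2.
Proof.
elim: s x => [|y s IHs] x /=; first by rewrite mul1r subrr expr0n /= mul0r.
rewrite big_cons /= (exprS (-1) (size s)) -(addn1 (size s)) natrD mulN1r mulNr.
move: (IHs y); set l := (-1) ^+ size s * _; set B := \sum_(_ <- _) _.
have B0 : 0 <= B by apply: sumr_ge0 => e _; exact: sqr_ge0.
rewrite -/l.
set v := f y - l; set n : R := (size s)%:R.
(* Prepending a vertex flips the sign of the old alternating sum [v], so the new one is [u - v]. *)
have -> : f x - - l = (f x + f y) - v by rewrite /v; ring.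
set u := f x + f y => vB.
(* The case [n = 0] is apart because a factor [n] is cancelled below; there [vB] forces [v = 0]. *)
have [n0|n0] := eqVneq (size s) 0%N.
  have v0 : v = 0.
    by apply/eqP; rewrite -sqrf_eq0 eq_le sqr_ge0 andbT (le_trans vB)// /n n0 mul0r.
  rewrite v0 /n n0; lra.
have n_gt0 : 0 < n by rewrite ltr0n lt0n.
(* By [vB] this product is at least [(n * u + v) ^+ 2]. Once [n] is cancelled, it and [vB] add up to
   the goal [(u - v) ^+ 2 <= (n + 1) * (u ^+ 2 + B)]. *)
have cross : 0 <= n * (n * u ^+ 2 + B + 2 * u * v).
  have := sqr_ge0 (n * u + v); lra.
rewrite pmulr_rge0// in cross; lra.
Qed.

Lemma odd_path_sqr_le (R : realFieldType) (S : eqType) (f : S -> R)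
    (x : S) (s : seq S) : odd (size s) ->
  (f x + f (last x s)) ^+ 2 <=
  (size s)%:R * \sum_(e <- pairmap pair x s) (f e.1 + f e.2) ^+ 2.
Proof.
move=> s_odd; have := alternating_path_sqr_le f x s.
by rewrite -signr_odd s_odd expr1 mulN1r opprK.
Qed.

(** Turns a sum along a path into a sum over edges weighted by traversal counts. *)
Lemma sum_count_mem (R : pzRingType) (I : finType) (s : seq I) (G : I -> R) :
  \sum_(e <- s) G e = \sum_i (count_mem i s)%:R * G i.
Proof.
elim: s => [|e s IHs] /=.
  by rewrite big_nil big1// => i _; rewrite mul0r.
rewrite big_cons IHs; under [RHS]eq_bigr do rewrite natrD mulrDl.
rewrite big_split /=; congr (_ + _).
rewrite (bigD1 e)//= eqxx mul1r big1 ?addr0// => i.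
by rewrite eq_sym => /negPf ->; rewrite mul0r.
Qed.

(** * Positivity of the stationary distribution *)

Lemma stationary_kernel_pow (R : realType) (S : finType) (P : S -> S -> R)
    (pi : S -> R) : stationary P pi ->
  forall n y, \sum_x pi x * kernel_pow P n x y = pi y.
Proof.
move=> [_ piP]; elim=> [|n IHn] y /=.
  rewrite (bigD1 y)//= eqxx mulr1 big1 ?addr0// => x /negPf ->.
  by rewrite mulr0.
under eq_bigr do rewrite mulr_sumr; rewrite exchange_big /= -[RHS]IHn.
apply: eq_bigr => z _; rewrite -[in RHS]piP mulr_suml.
by apply: eq_bigr => x _; rewrite mulrA.
Qed.

Lemma dist_gt0 (R : realType) (S : finType) (p : S -> R) :
  is_dist p -> exists x, 0 < p x.
Proof.
move=> [p0 p1]; apply/existsP; apply: contraT.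
rewrite negb_exists => /forallP p_npos.
suff : \sum_x p x = 0 by rewrite p1 => /eqP; rewrite oner_eq0.
by apply: big1 => x _; apply/eqP; rewrite eq_le p0 leNgt p_npos.
Qed.

(** Some [x] has positive mass, irreducibility gives an [n] for which [y] is reached from [x] in [n]
    steps, and [pi] is invariant under the [n]-step kernel. *)
Lemma stationary_gt0 (R : realType) (S : finType) (P : S -> S -> R)
    (pi : S -> R) : is_kernel P -> irreducible P -> stationary P pi ->
  forall y, 0 < pi y.
Proof.
move=> P_kernel P_irr P_stat y; have [[pi0 _] _] := P_stat.
have pow0 n x z : 0 <= kernel_pow P n x z.
  elim: n x => [|n IHn] x /=; first by rewrite ler0n.
  by apply: sumr_ge0 => t _; rewrite mulr_ge0//; case: (P_kernel x).
have [x pix] := dist_gt0 P_stat.1.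
have [n powxy] := P_irr x y; rewrite -(stationary_kernel_pow P_stat n).
rewrite (bigD1 x)//= ltr_pwDl ?mulr_gt0//.
by apply: sumr_ge0 => z _; rewrite mulr_ge0.
Qed.

(** * Nonnegative extended sums over the set of paths *)

Lemma ge0_esumZl (R : realType) (I : choiceType) (A : set I) (r : R)
    (a : I -> \bar R) : 0 <= r -> (forall i, 0%E <= a i)%E ->
  (\esum_(i in A) (r%:E * a i) = r%:E * \esum_(i in A) a i)%E.
Proof.
move=> r0 a0; rewrite /esum -ereal_supZl//; last first.
  by apply/set0P; exists 0%E, set0; [exact: fsets_set0|rewrite fsbigop.fsbig_set0].
congr (ereal_sup _); apply/seteqP; split=> [_ [X AX <-]|_ [_ [X AX <-] <-]].
  by exists (\sum_(i \in X) a i)%E; [exists X|rewrite ge0_mule_fsumr].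
by exists X => //; rewrite ge0_mule_fsumr.
Qed.

(** The sets of paths with prescribed endpoints partition all paths. *)
Lemma sum_esum_paths_from_to (R : realType) (S : finType) (e : rel S)
    (h : epath e -> \bar R) : (forall g, 0%E <= h g)%E ->
  (\sum_(ab : S * S) \esum_(g in paths_from_to ab.1 ab.2) h g =
   \esum_(g in [set: epath e]) h g)%E.
Proof.
move=> h0; under eq_bigr do rewrite esum_mkcond.
rewrite -esum_sum; last by move=> g ab _ _; case: ifP.
apply: eq_esum => g _; rewrite (bigD1 (pinit g, pfinal g))//= ifT; last first.
  by rewrite inE.
rewrite big1 ?adde0// => -[a b] /= ab; rewrite ifF//; apply/negP.
by rewrite inE => -[ia ib]; rewrite ia ib eqxx in ab.
Qed.

Lemma sum_pairE (R : nmodType) (I J : finType) (G : I * J -> R) :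
  \sum_p G p = \sum_i \sum_j G (i, j).
Proof. by rewrite pair_bigA; apply: eq_bigr => -[]. Qed.

(** * Jensen's inequality along the couplings *)

Section Weights.
Variables (R : realType) (T : finType) (Om : {set T}).
Local Notation V := {x : T | x \in Om}.
Variables (K : T -> T -> R) (mu : T -> R).
Variables (P : T -> V -> R) (C : T -> T -> V * V -> R).

(* The mass that the pairs (x, y), transported to Om * Om by the couplings,
   put on ab; the factor 2 merges, by reversibility, the pairs leaving Om with
   those entering it, and for these the coupling is delta_x times P_y. *)
Definition end_weight (ab : V * V) : R :=
  K (val ab.1) (val ab.2) * mu (val ab.1)
  + 2 * (\sum_(y | y \notin Om) P y ab.2 * K (val ab.1) y * mu (val ab.1))
  + \sum_(xy : T * T | [&& edge K xy.1 xy.2, xy.1 \notin Om & xy.2 \notin Om])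
      C xy.1 xy.2 ab * K xy.1 xy.2 * mu xy.1.

Hypotheses (K_kernel : is_kernel K) (mu_ge0 : forall x, 0 <= mu x).
Hypothesis K_reversible : reversible K mu.
Hypothesis P_dist : forall x, is_dist (P x).
Hypothesis P_delta : forall x y : V, P (val x) y = (x == y)%:R.
Hypothesis C_coupling :
  forall x y, edge K x y -> is_coupling (C x y) (P x) (P y).

Let K_ge0 x y : 0 <= K x y. Proof. by case: (K_kernel x). Qed.

Lemma end_direct_ge0 (a b : T) : 0 <= K a b * mu a.
Proof. exact: mulr_ge0. Qed.

Lemma end_outward_ge0 (a b : V) :
  0 <= \sum_(y | y \notin Om) P y b * K (val a) y * mu (val a).
Proof.
apply: sumr_ge0 => y _; rewrite -mulrA mulr_ge0 ?mulr_ge0//.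
by case: (P_dist y).
Qed.

Lemma end_outer_ge0 (ab : V * V) :
  0 <= \sum_(xy : T * T |
              [&& edge K xy.1 xy.2, xy.1 \notin Om & xy.2 \notin Om])
         C xy.1 xy.2 ab * K xy.1 xy.2 * mu xy.1.
Proof.
apply: sumr_ge0 => -[x y] /= /and3P[/C_coupling[[C0 _] _ _] _ _].
by rewrite -mulrA mulr_ge0// mulr_ge0.
Qed.

Lemma end_weight_ge0 ab : 0 <= end_weight ab.
Proof.
by rewrite !addr_ge0 ?mulr_ge0 ?end_outward_ge0 ?end_outer_ge0// ?ler0n.
Qed.

Variable f : V -> R.

Lemma extension_val (a : V) : extension P f (val a) = f a.
Proof.
rewrite /extension (bigD1 a)//= P_delta eqxx mul1r big1 ?addr0// => b.
by rewrite P_delta eq_sym => /negPf ->; rewrite mul0r.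
Qed.

(** As [P y] has mass one, [f a] moves inside the mean and Jensen applies to [P y]. This is the
    coupling estimate for the only coupling of a point mass at [a] with [P y]. *)
Lemma extension_inner_outer_le (a : V) y :
  (f a + extension P f y) ^+ 2 <= \sum_b P y b * (f a + f b) ^+ 2.
Proof.
have [P0 P1] := P_dist y; suff -> : f a + extension P f y = \sum_b P y b * (f a + f b).
  exact: sqr_mean_le.
under eq_bigr do rewrite mulrDr.
by rewrite big_split /= -mulr_suml P1 mul1r.
Qed.

(** The marginals of the coupling write the sum of the two extensions as one mean of [f a + f b], to
    which Jensen applies. *)
Lemma extension_coupling_le x y : edge K x y ->
  (extension P f x + extension P f y) ^+ 2 <=
  \sum_ab C x y ab * (f ab.1 + f ab.2) ^+ 2.
Proof.
move=> /C_coupling[[C0 C1] Cl Cr].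
suff -> : extension P f x + extension P f y =
    \sum_ab C x y ab * (f ab.1 + f ab.2) by exact: sqr_mean_le.
under [RHS]eq_bigr do rewrite mulrDr.
rewrite big_split /=; congr (_ + _).
  rewrite /extension sum_pairE /=.
  by apply: eq_bigr => a _; rewrite -mulr_suml Cl.
rewrite /extension sum_pairE exchange_big /=.
by apply: eq_bigr => b _; rewrite -mulr_suml Cr.
Qed.

Lemma sum_form_extension_le :
  sum_form K mu (extension P f) <=
  2^-1 * \sum_ab end_weight ab * (f ab.1 + f ab.2) ^+ 2.
Proof.
rewrite /sum_form ler_wpM2l ?invr_ge0 ?ler0n//.
set h := fun x y =>
  (extension P f x + extension P f y) ^+ 2 * (K x y * mu x).
(* Symmetry of the summand, from reversibility: pairs entering [Om] contribute as much as pairs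
   leaving it. *)
have hC x y : h x y = h y x.
  by rewrite /h addrC mulrC [_ * mu _]mulrC K_reversible mulrC [mu _ * _]mulrC.
under eq_bigr do under eq_bigr do rewrite -normrX ger0_norm ?sqr_ge0// -mulrA.
(* Pairs are sorted by how many of their endpoints lie in [Om], matching the three terms of
   [end_weight]. *)
have -> : \sum_x \sum_y h x y =
    \sum_(ab : V * V) h (val ab.1) (val ab.2)
    + 2 * (\sum_(a : V) \sum_(y | y \notin Om) h (val a) y)
    + \sum_(xy : T * T | (xy.1 \notin Om) && (xy.2 \notin Om)) h xy.1 xy.2.
  have -> : \sum_(ab : V * V) h (val ab.1) (val ab.2) =
      \sum_(x in Om) \sum_(y in Om) h x y.
    by rewrite sum_pairE [RHS]big_sub; apply: eq_bigr => a _; rewrite [RHS]big_sub.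
  have -> : \sum_(a : V) \sum_(y | y \notin Om) h (val a) y =
      \sum_(x in Om) \sum_(y | y \notin Om) h x y by rewrite [RHS]big_sub.
  rewrite -(pair_big (fun x => x \notin Om) (fun y => y \notin Om) h) /=.
  have swap : \sum_(x | x \notin Om) \sum_(y in Om) h x y =
      \sum_(x in Om) \sum_(y | y \notin Om) h x y.
    by rewrite exchange_big; apply: eq_bigr => y _; apply: eq_bigr => x _.
  rewrite (bigID (mem Om)) /=.
  under eq_bigr do rewrite (bigID (mem Om)) /=.
  under [X in _ + X]eq_bigr do rewrite (bigID (mem Om)) /=.
  rewrite !big_split /= swap; ring.
under [leRHS]eq_bigr do rewrite /end_weight 2!mulrDl.
rewrite !big_split /= !lerD//.
- by rewrite ler_sum// => -[a b] _ /=; rewrite /h !extension_val mulrC.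
- under [leRHS]eq_bigr do rewrite -mulrA.
  rewrite -mulr_sumr ler_wpM2l ?ler0n//.
  under [leRHS]eq_bigr do rewrite mulr_suml.
  rewrite sum_pairE /=.
  apply: ler_sum => a _; rewrite exchange_big /=; apply: ler_sum => y _.
  rewrite /h extension_val.
  apply: le_trans (ler_wpM2r _ (extension_inner_outer_le _ _)) _.
    exact: mulr_ge0.
  rewrite mulr_suml; apply: ler_sum => b _.
  by rewrite [leLHS]mulrAC !mulrA.
under [leRHS]eq_bigr do rewrite mulr_suml.
rewrite exchange_big /= big_mkcond [leRHS]big_mkcond.
(* The couplings are given on edges only; off the edges [K x y = 0], so the summand vanishes. *)
apply: ler_sum => -[x y] _ /=; have [xy|xy] := boolP (edge K x y); last first.
  have -> : h x y = 0.
    rewrite /edge lt_neqAle K_ge0 andbT negbK in xy.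
    by rewrite /h -(eqP xy) mul0r mulr0.
  by case: ifP.
rewrite andTb; case: ifP => // _.
apply: le_trans (ler_wpM2r _ (extension_coupling_le xy)) _.
  exact: mulr_ge0.
rewrite mulr_suml; apply: ler_sum => ab _.
by rewrite [leLHS]mulrAC !mulrA.
Qed.

End Weights.

(** * Averaging over the flow and exchanging paths with edges *)

Lemma flow_sqr_le (R : realType) (S : finType) (e : rel S) (F : epath e -> R)
    (w : S * S -> R) (f : S -> R) :
  is_flow F -> (forall g, ~~ odd (plen g) -> F g = 0) ->
  (forall ab, 0 <= w ab) ->
  ((\sum_ab w ab * (f ab.1 + f ab.2) ^+ 2)%:E <=
   \sum_(qr : S * S) ((f qr.1 + f qr.2) ^+ 2)%:E *
     \esum_(g in paths_through e qr)
       (F g * (traversals qr g)%:R * (plen g)%:R * w (pinit g, pfinal g))%:E)%E.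
Proof.
move=> [F01 F1] F_odd w0.
have F0 g : 0 <= F g by case/andP: (F01 g).
pose D qr := (f qr.1 + f qr.2) ^+ 2.
have D0 qr : 0 <= D qr by exact: sqr_ge0.
pose c qr g :=
  F g * (traversals qr g)%:R * (plen g)%:R * w (pinit g, pfinal g).
have c0 qr g : 0 <= c qr g by rewrite !mulr_ge0.
(* The intermediate quantity sums over paths grouped by endpoints, each path's cost being already
   spread over the edges it traverses. *)
apply: (@le_trans _ _
  (\sum_(ab : S * S) \esum_(g in paths_from_to ab.1 ab.2)
     \sum_qr (D qr)%:E * (c qr g)%:E)%E).
  rewrite -sumEFin; apply: lee_sum => ab _.
  (* The unit mass of the flow between the two endpoints replaces the factor 1, which reduces the
     claim to a single path. *)
  rewrite -[leLHS]mule1 -(F1 ab.1 ab.2) -ge0_esumZl; last 2 first.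
  - rewrite mulr_ge0 ?sqr_ge0//.
  - by move=> g; rewrite lee_fin.
  apply: le_esum => g [ga gb].
  under eq_bigr do rewrite -EFinM.
  rewrite sumEFin -EFinM lee_fin.
  (* The path inequality holds for odd length; even paths carry no flow and contribute zero. *)
  have [g_odd|/F_odd Fg0] := boolP (odd (plen g)); last first.
    by rewrite Fg0 mulr0 sumr_ge0// => qr _; rewrite mulr_ge0.
  have -> : \sum_qr D qr * c qr g =
      w ab * F g * ((plen g)%:R * \sum_qr (traversals qr g)%:R * D qr).
    rewrite !mulr_sumr; apply: eq_bigr => qr _.
    by rewrite /c ga gb -surjective_pairing; ring.
  rewrite mulrAC ler_wpM2l ?mulr_ge0// -ga -gb.
  rewrite /traversals -(sum_count_mem _ D); exact: odd_path_sqr_le.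
rewrite sum_esum_paths_from_to; last first.
  by move=> g; apply: sume_ge0 => qr _; rewrite -EFinM lee_fin mulr_ge0.
rewrite esum_sum; last by move=> g qr _ _; rewrite -EFinM lee_fin mulr_ge0.
apply: lee_sum => qr _; rewrite ge0_esumZl; [|exact: D0|by move=> g; rewrite lee_fin].
apply: lee_wpmul2l; first by rewrite lee_fin.
rewrite [leRHS]esum_mkcond; apply: le_esum => g _.
(* A path avoiding [qr] has traversal count zero, so restricting to the paths through [qr] loses
   nothing. *)
case: ifPn => //; rewrite notin_setE /= => /negP.
by rewrite -eqn0Ngt => /eqP t0; rewrite /c t0 mulr0 !mul0r.
Qed.

(** * Edge congestion expressed by the end weight *)

Lemma mem_pairmap_path (S : eqType) (e : rel S) (x : S) (s : seq S)
    (qr : S * S) :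
  path e x s -> qr \in pairmap pair x s -> e qr.1 qr.2.
Proof.
elim: s x => [|y s IHs] x //= /andP[exy /IHs s_path].
by rewrite inE => /orP[/eqP ->|].
Qed.

(** Every step of a path is an edge. This handles the pairs on which the supremum defining the
    constant gives no bound. *)
Lemma paths_through_not_edge (S : finType) (e : rel S) (qr : S * S) :
  ~~ e qr.1 qr.2 -> paths_through e qr = classical_sets.set0.
Proof.
move=> not_e; rewrite -subset0 => g; rewrite /paths_through /= /traversals.
rewrite -has_count has_pred1 => /(mem_pairmap_path (valP g)).
by rewrite (negPf not_e).
Qed.

(** All terms are nonnegative, so the three extended sums merge into one, whose bracket is exactly
    [end_weight] at the endpoints of the path. *)
Lemma edge_congestion_endE (R : realType) (T : finType) (Om : {set T})
    (K : T -> T -> R) (mu : T -> R)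
    (Q : {x : T | x \in Om} -> {x : T | x \in Om} -> R)
    (nu : {x : T | x \in Om} -> R)
    (P : T -> {x : T | x \in Om} -> R)
    (C : T -> T -> {x : T | x \in Om} * {x : T | x \in Om} -> R)
    (F : epath (edge Q) -> R) qr :
  is_kernel K -> (forall x, 0 <= mu x) -> (forall x, is_dist (P x)) ->
  (forall x y, edge K x y -> is_coupling (C x y) (P x) (P y)) ->
  (forall g, 0 <= F g) ->
  edge_congestion K mu nu P C F qr =
  (((Q qr.1 qr.2 * nu qr.1)^-1)%:E *
   \esum_(g in paths_through (edge Q) qr)
     (F g * (traversals qr g)%:R * (plen g)%:R *
      end_weight K mu P C (pinit g, pfinal g))%:E)%E.
Proof.
move=> K_kernel mu0 P_dist C_coupling F0; rewrite /edge_congestion.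
have K0 x y : 0 <= K x y by case: (K_kernel x).
rewrite -ge0_esumZl//; last first.
  by move=> g; rewrite lee_fin mulr_ge0 ?end_outward_ge0 ?mulr_ge0.
rewrite -esumD; last 2 first.
- by move=> g _; rewrite lee_fin mulr_ge0 ?end_direct_ge0 ?mulr_ge0.
- by move=> g _; rewrite -EFinM lee_fin !mulr_ge0 ?end_outward_ge0 ?ler0n.
rewrite -esumD; last 2 first.
- move=> g _; rewrite -EFinM -EFinD lee_fin addr_ge0//.
    by rewrite mulr_ge0 ?end_direct_ge0 ?mulr_ge0.
  by rewrite !mulr_ge0 ?end_outward_ge0 ?ler0n.
- by move=> g _; rewrite lee_fin mulr_ge0 ?(end_outer_ge0 (P := P))// !mulr_ge0.
congr (_ * _)%E; apply: eq_esum => g _.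
by rewrite -EFinM -!EFinD; congr (_%:E); rewrite /end_weight /=; ring.
Qed.

(** * Comparison of the two forms through the worst edge congestion *)

Theorem theorem11 (R : realType) (T : finType) (Om : {set T})
    (K : T -> T -> R) (mu : T -> R)
    (Q : {x : T | x \in Om} -> {x : T | x \in Om} -> R)
    (nu : {x : T | x \in Om} -> R)
    (P : T -> {x : T | x \in Om} -> R)
    (C : T -> T -> {x : T | x \in Om} * {x : T | x \in Om} -> R)
    (F : epath (edge Q) -> R)
    (K_kernel : is_kernel K) (K_ergodic : ergodic K)
    (K_irreducible : irreducible K)
    (mu_stationary : stationary K mu) (K_reversible : reversible K mu)
    (Q_kernel : is_kernel Q) (Q_ergodic : ergodic Q)
    (Q_irreducible : irreducible Q)
    (nu_stationary : stationary Q nu) (Q_reversible : reversible Q nu)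
    (P_dist : forall x : T, is_dist (P x))
    (P_delta : forall x y : {x : T | x \in Om}, P (val x) y = (x == y)%:R)
    (C_coupling : forall x y : T, edge K x y -> is_coupling (C x y) (P x) (P y))
    (F_flow : is_flow F)
    (F_odd : forall g : epath (edge Q), ~~ odd (plen g) -> F g = 0)
    (f : {x : T | x \in Om} -> R) :
  ((sum_form K mu (extension P f))%:E
     <= comparison_constant K mu nu P C F * (sum_form Q nu f)%:E)%E.

Proof.
have [[mu0 _] _] := mu_stationary.
have nu0 := stationary_gt0 Q_kernel Q_irreducible nu_stationary.
have F0 g : 0 <= F g by case: F_flow => /(_ g)/andP[].
have Q0 q r : 0 <= Q q r by case: (Q_kernel q).
set A := comparison_constant K mu nu P C F.
pose D qr := (f qr.1 + f qr.2) ^+ 2.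
pose S qr := (\esum_(g in paths_through (edge Q) qr)
  (F g * (traversals qr g)%:R * (plen g)%:R *
   end_weight K mu P C (pinit g, pfinal g))%:E)%E.
have w0 := end_weight_ge0 K_kernel mu0 P_dist C_coupling.
have S0 qr : (0 <= S qr)%E.
  by apply: esum_ge0 => g _; rewrite lee_fin !mulr_ge0.
have S_le q r : 0 < Q q r -> (S (q, r) <= (Q q r * nu q)%:E * A)%E.
  move=> Qqr; rewrite -lee_pdivrMl ?mulr_gt0//.
  rewrite -(edge_congestion_endE nu (q, r) K_kernel mu0 P_dist C_coupling F0).
  by apply: ereal_sup_ubound; exists (q, r).
(* A supremum over no edges would be minus infinity. Since [nu] has total mass one there is a point
   [q], and the row [Q q] charges some [r], so an edge exists. *)
have A0 : (0 <= A)%E.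
  have [q _] := dist_gt0 nu_stationary.1.
  have [r Qqr] := dist_gt0 (Q_kernel q).
  have := le_trans (S0 (q, r)) (S_le q r Qqr).
  by rewrite pmule_rge0// lte_fin mulr_gt0.
have sum_form_Q : sum_form Q nu f =
    2^-1 * \sum_qr D qr * (Q qr.1 qr.2 * nu qr.1).
  rewrite /sum_form sum_pairE; congr (_ * _).
  apply: eq_bigr => q _; apply: eq_bigr => r _ /=.
  by rewrite -normrX ger0_norm ?sqr_ge0// -mulrA.
apply: (@le_trans _ _
  (2^-1 * \sum_ab end_weight K mu P C ab * (f ab.1 + f ab.2) ^+ 2)%:E).
  by rewrite lee_fin; exact: sum_form_extension_le.
rewrite sum_form_Q !EFinM muleCA; apply: lee_wpmul2l.
  by rewrite lee_fin invr_ge0.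
apply: le_trans (flow_sqr_le f F_flow F_odd w0) _.
rewrite -sumEFin ge0_sume_distrr; last first.
  move=> qr _; rewrite lee_fin mulr_ge0 ?sqr_ge0// mulr_ge0//.
  exact: ltW.
(* The comparison is made pair by pair: edges use the supremum; on other pairs [S] is an empty sum
   and the right side is nonnegative by [A0]. *)
apply: lee_sum => -[q r] _; rewrite -/(S _) (EFinM (D (q, r))) muleCA.
apply: lee_wpmul2l; first by rewrite lee_fin sqr_ge0.
rewrite muleC; have [Qqr|Qqr] := boolP (edge Q q r); first exact: S_le.
rewrite /S paths_through_not_edge// esum_set0 mule_ge0//.
by rewrite lee_fin mulr_ge0// ltW.
Qed.
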